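(* Let $W=W(\Gamma,\mathbf m)$ be a graph product of directly-indecomposable cyclic groups. For each full subgraph $\Omega\subseteq\Gamma$ the following holds: for every $\phi\in\operatorname{Aut}^0 W$ the map $\phi_\Omega: V\to W$ extends to an automorphism of $W$ (also denoted $\phi_\Omega$), and the map $\phi\mapsto\phi_\Omega$ is a retraction homomorphism $\operatorname{Aut}^0 W\to\langle\mathcal P_\Omega\rangle$ (that is, a homomorphism with image in $\langle\mathcal P_\Omega\rangle$ which restricts to the identity on $\langle\mathcal P_\Omega\rangle$).
   Context: $\Gamma$ is a finite simplicial graph with non-empty vertex set $V=\{v_1,\dots,v_N\}$. An order map is a function $\mathbf m:\{1,\dots,N\}\to\{p^\alpha : p \text{ prime},\ \alpha\ge 1\}\cup\{\infty\}$. The graph product of directly-indecomposable cyclic groups $W=W(\Gamma,\mathbf m)$ is the group with generators $V$ and relations $v_i^{\mathbf m(i)}=1$ (no relation if $\mathbf m(i)=\infty$) and $v_jv_k=v_kv_j$ whenever $v_j,v_k$ are adjacent in $\Gamma$. For a full subgraph $\Omega$, $W(\Omega)$ is the subgroup generated by the vertices of $\Omega$, and $pr_\Omega:W\to W(\Omega)$ is the retraction which fixes each vertex in $\Omega$ and sends each vertex not in $\Omega$ to $1$. $\operatorname{Aut}^0 W$ is the group of automorphisms of $W$ which map each vertex $v_i$ to a conjugate of itself. $S_i$ denotes the star of $v_i$ (the full subgraph on the vertices at distance at most $1$ from $v_i$). For $1\le i\le N$ and $K$ a connected component of $\Gamma\setminus S_i$, the partial conjugation $\chi_{iK}$ is the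 automorphism of $W$ with $\chi_{iK}(v_j)=v_iv_jv_i^{-1}$ if $v_j\in K$ and $\chi_{iK}(v_j)=v_j$ if $v_j\notin K$. $\mathcal P$ is the set of all partial conjugations and $\mathcal P_\Omega=\{\chi_{iQ}\in\mathcal P: v_i\in\Omega\}$. For $\phi\in\operatorname{Aut}^0W$ and $w_1,\dots,w_N\in W$ with $\phi(v_i)=w_iv_iw_i^{-1}$ for each $i$, the map $\phi_\Omega:V\to W$ is defined by $v_i\mapsto pr_\Omega(w_i)\,v_i\,pr_\Omega(w_i)^{-1}$ (this does not depend on the choice of the $w_i$). *)

(* Defs.v *)
From HB Require Import structures.
From mathcomp Require Import all_boot.
From mathcomp Require Import boolp classical_sets.

Set Implicit Arguments.
Unset Strict Implicit.
Unset Printing Implicit Defensive.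

Local Open Scope quotient_scope.
Local Open Scope group_scope.

(* The letter (x, false) stands for x and (x, true) for its formal inverse. *)
Definition word (X : finType) : Type := seq (X * bool).

Section Presentation.
Variables (X : finType) (R : word X -> word X -> Prop).

Definition letter_inv (a : X * bool) : X * bool := (a.1, ~~ a.2).

Inductive word_cong : word X -> word X -> Prop :=
| word_cong_rel s t : R s t -> word_cong s t
| word_cong_cancel a : word_cong [:: a; letter_inv a] [::]
| word_cong_cat s s' t t' :
    word_cong s s' -> word_cong t t' -> word_cong (s ++ t) (s' ++ t')
| word_cong_refl s : word_cong s s
| word_cong_sym s t : word_cong s t -> word_cong t s
| word_cong_trans s t u : word_cong s t -> word_cong t u -> word_cong s u.

Definition word_eqv : rel (word X) := fun s t => `[< word_cong s t >].

Fact word_eqv_refl : reflexive word_eqv.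
Proof. by move=> s; apply/asboolP; apply: word_cong_refl. Qed.
Fact word_eqv_sym : symmetric word_eqv.
Proof. by move=> s t; apply/asboolP/asboolP; apply: word_cong_sym. Qed.
Fact word_eqv_trans : transitive word_eqv.
Proof.
move=> t s u /asboolP st /asboolP tu; apply/asboolP.
exact: word_cong_trans st tu.
Qed.
Canonical word_eqv_equiv :=
  EquivRel word_eqv word_eqv_refl word_eqv_sym word_eqv_trans.

Definition presented : Type := {eq_quot word_eqv}.
HB.instance Definition _ := EqQuotient.on presented.
HB.instance Definition _ := Choice.on presented.

Lemma word_congP s t :
  reflect (\pi_presented s = \pi_presented t) `[< word_cong s t >].
Proof. exact: (@eqmodP _ word_eqv_equiv s t). Qed.

Lemma word_cong_repr s : word_cong (repr (\pi_presented s)) s.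
Proof. by apply/asboolP/word_congP; rewrite reprK. Qed.

Definition word_inv (s : word X) : word X := rev (map letter_inv s).

Lemma letter_invK : involutive letter_inv.
Proof. by case=> x b; rewrite /letter_inv negbK. Qed.

Lemma word_invK : involutive word_inv.
Proof. by move=> s; rewrite /word_inv map_rev revK mapK //; apply: letter_invK. Qed.

Lemma word_cong_mulV s : word_cong (s ++ word_inv s) [::].
Proof.
elim: s => [|a s IH]; first exact: word_cong_refl.
rewrite /word_inv /= rev_cons -cats1 -cat1s -/(word_inv s).
apply: word_cong_trans (word_cong_cancel a).
rewrite -[X in word_cong _ X]/([:: a] ++ [::] ++ [:: letter_inv a]).
rewrite catA -!catA; apply: word_cong_cat; first exact: word_cong_refl.
by rewrite !catA; apply: word_cong_cat => //; apply: word_cong_refl.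
Qed.

Lemma word_cong_mulVs s : word_cong (word_inv s ++ s) [::].
Proof. by have := word_cong_mulV (word_inv s); rewrite word_invK. Qed.

Definition pres_one : presented := \pi_presented [::].
Definition pres_mul (x y : presented) : presented := \pi_presented (repr x ++ repr y).
Definition pres_inv (x : presented) : presented := \pi_presented (word_inv (repr x)).

Lemma pi_mul s t : pres_mul (\pi_presented s) (\pi_presented t) = \pi_presented (s ++ t).
Proof.
by apply/word_congP/asboolP; apply: word_cong_cat; apply: word_cong_repr.
Qed.

Fact pres_mulA : associative pres_mul.
Proof.
move=> x y z; rewrite -[x]reprK -[y]reprK -[z]reprK.
move: (repr x) (repr y) (repr z) => s t u.
by rewrite (pi_mul t u) (pi_mul s (t ++ u)) (pi_mul s t) (pi_mul (s ++ t) u) catA.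
Qed.
Fact pres_mul1 : left_id pres_one pres_mul.
Proof. by move=> x; rewrite -[x]reprK (pi_mul [::]). Qed.
Fact pres_mulr1 : right_id pres_one pres_mul.
Proof. by move=> x; rewrite -[x]reprK (pi_mul _ [::]) cats0. Qed.
Fact pres_mulVx : left_inverse pres_one pres_inv pres_mul.
Proof.
move=> x; rewrite -[x in pres_mul _ x]reprK /pres_inv (pi_mul (word_inv _)).
by apply/word_congP/asboolP; apply: word_cong_mulVs.
Qed.
Fact pres_mulxV : right_inverse pres_one pres_inv pres_mul.
Proof.
move=> x; rewrite -[x in pres_mul x]reprK /pres_inv (pi_mul _ (word_inv _)).
by apply/word_congP/asboolP; apply: word_cong_mulV.
Qed.

HB.instance Definition _ := isGroup.Build presented
  pres_mulA pres_mul1 pres_mulr1 pres_mulVx pres_mulxV.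

Definition pres_gen (x : X) : presented := \pi_presented [:: (x, false)].

End Presentation.

Section Lift.
Variables (X : finType) (R : word X -> word X -> Prop) (G : groupType).
Variable f : X -> G.

Definition word_eval (s : word X) : G :=
  \prod_(a <- s) (if a.2 then (f a.1)^-1 else f a.1).

(* The homomorphism extending f when f satisfies the relations R
   (see [pres_liftM] and [pres_lift_gen]); meaningless otherwise. *)
Definition pres_lift (x : presented R) : G := word_eval (repr x).

Hypothesis fR : forall s t, R s t -> word_eval s = word_eval t.

Lemma word_eval_cong s t : word_cong R s t -> word_eval s = word_eval t.
Proof.
elim=> {s t} [|[x b]|s s' t t' _ IHs _ IHt| |s t _ ->|s t u _ -> _ ->] //.
- rewrite /word_eval !big_cons !big_nil /= mulg1.
  by case: b; rewrite /= ?mulgV ?mulVg.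
- by rewrite /word_eval !big_cat /= -!/(word_eval _) IHs IHt.
Qed.

Lemma pres_lift_pi s : pres_lift (\pi_(presented R) s) = word_eval s.
Proof. exact/word_eval_cong/word_cong_repr. Qed.

Lemma pres_liftM : {morph pres_lift : x y / x * y}.
Proof.
move=> x y; rewrite -[x]reprK -[y]reprK [_ * _]pi_mul !pres_lift_pi.
by rewrite /word_eval big_cat.
Qed.

Lemma pres_lift_gen x : pres_lift (pres_gen R x) = f x.
Proof. by rewrite pres_lift_pi /word_eval big_seq1. Qed.

End Lift.

Section Aut.
Variable G : groupType.

Definition is_aut (f : G -> G) : Prop := bijective f /\ {morph f : x y / x * y}.

Record aut := Aut { aut_fun :> G -> G; _ : `[< is_aut aut_fun >] }.

HB.instance Definition _ := [isSub for aut_fun].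
HB.instance Definition _ := [Choice of aut by <:].

Lemma autP (phi psi : aut) : phi =1 psi -> phi = psi.
Proof. by move=> e; apply/val_inj/funext. Qed.

Lemma aut_is_aut (phi : aut) : is_aut phi.
Proof. by case: phi => f /= /asboolP. Qed.

Lemma autM (phi : aut) : {morph phi : x y / x * y}.
Proof. by case: (aut_is_aut phi). Qed.

Fact aut1_subproof : `[< is_aut (@id G) >].
Proof. by apply/asboolP; split=> //; exists id. Qed.
Definition aut_one : aut := Aut aut1_subproof.

Fact autM_subproof (phi psi : aut) : `[< is_aut (phi \o psi) >].
Proof.
have [bf mf] := aut_is_aut phi; have [bg mg] := aut_is_aut psi.
by apply/asboolP; split; [apply: bij_comp | move=> x y; rewrite /= mg mf].
Qed.
Definition aut_mul (phi psi : aut) : aut := Aut (autM_subproof phi psi).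

Fact autV_subproof (phi : aut) : exists psi : aut, cancel psi phi /\ cancel phi psi.
Proof.
have [[g fg gf] mf] := aut_is_aut phi.
have gA : `[< is_aut g >].
  apply/asboolP; split; first by exists phi.
  by move=> x y; apply: (can_inj fg); rewrite gf mf !gf.
by exists (Aut gA).
Qed.
Definition aut_inv (phi : aut) : aut := projT1 (cid (autV_subproof phi)).

Lemma aut_invK (phi : aut) : cancel (aut_inv phi) phi /\ cancel phi (aut_inv phi).
Proof. exact: (projT2 (cid (autV_subproof phi))). Qed.

Fact aut_mulA : associative aut_mul.
Proof. by move=> f g h; apply: autP. Qed.
Fact aut_mul1 : left_id aut_one aut_mul.
Proof. by move=> f; apply: autP. Qed.
Fact aut_mulr1 : right_id aut_one aut_mul.
Proof. by move=> f; apply: autP. Qed.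
Fact aut_mulVx : left_inverse aut_one aut_inv aut_mul.
Proof. by move=> f; apply: autP => x /=; apply: (aut_invK f).2. Qed.
Fact aut_mulxV : right_inverse aut_one aut_inv aut_mul.
Proof. by move=> f; apply: autP => x /=; apply: (aut_invK f).1. Qed.

HB.instance Definition _ :=
  isGroup.Build aut aut_mulA aut_mul1 aut_mulr1 aut_mulVx aut_mulxV.

Lemma aut_oneE x : (1 : aut) x = x. Proof. by []. Qed.
Lemma aut_mulE (phi psi : aut) x : (phi * psi) x = phi (psi x).
Proof. by []. Qed.

End Aut.

Section GeneratedSubgroup.
Variable G : groupType.

Definition is_subgroup (H : set G) : Prop := group_closed [pred x | x \in H].

Definition gen_subgroup (S : set G) : set G := smallest is_subgroup S.

Lemma gen_subgroup_is_subgroup (S : set G) : is_subgroup (gen_subgroup S).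
Proof.
split=> [|x y]; rewrite !inE.
  by move=> H [[H1 _] _]; move: H1; rewrite !inE.
move=> Sx Sy H [HH SH]; case: (HH) => _ HF.
by have := HF x y; rewrite !inE; apply; [apply: Sx | apply: Sy].
Qed.

End GeneratedSubgroup.

(* [m v = Some n] means that v has finite order n, and [m v = None] that it
   has infinite order. *)
Definition order_map (V : finType) (m : V -> option nat) : Prop :=
  forall v n, m v = Some n ->
    exists p alpha : nat, [/\ prime p, (1 <= alpha)%N & n = (p ^ alpha)%N].

Section GraphProduct.
Variables (V : finType) (adj : rel V) (m : V -> option nat).

Inductive gp_rel : word V -> word V -> Prop :=
| gp_rel_order v n : m v = Some n -> gp_rel (nseq n (v, false)) [::]
| gp_rel_comm u v :
    adj u v -> gp_rel [:: (u, false); (v, false)] [:: (v, false); (u, false)].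

Definition gprod : Type := presented gp_rel.
HB.instance Definition _ := Group.on gprod.

Definition gen (v : V) : gprod := pres_gen gp_rel v.

Lemma gen_order v n : m v = Some n -> gen v ^+ n = 1.
Proof.
move=> mv.
have E k : \pi_(presented gp_rel) (nseq k (v, false)) = gen v ^+ k.
  elim: k => [|k IH]; first by [].
  by rewrite expgS -IH [RHS]pi_mul.
by rewrite -E; apply/word_congP/asboolP/word_cong_rel; apply: gp_rel_order.
Qed.

Lemma gen_comm u v : adj u v -> gen u * gen v = gen v * gen u.
Proof.
move=> uv; rewrite [LHS]pi_mul [RHS]pi_mul.
by apply/word_congP/asboolP/word_cong_rel; apply: gp_rel_comm.
Qed.

Section GprodLift.
Variables (G : groupType) (f : V -> G).
Hypothesis f_order : forall v n, m v = Some n -> f v ^+ n = 1.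
Hypothesis f_comm : forall u v, adj u v -> f u * f v = f v * f u.

Lemma gp_rel_eval s t : gp_rel s t -> word_eval f s = word_eval f t.
Proof.
case=> [v n /f_order fn|u v /f_comm fuv].
  by rewrite /word_eval big_nseq big_nil /= iter_mulg_1.
by rewrite /word_eval !big_cons !big_nil /= !mulg1.
Qed.

Lemma gprod_liftM : {morph (pres_lift f : gprod -> G) : x y / x * y}.
Proof. exact/pres_liftM/gp_rel_eval. Qed.

Lemma gprod_lift_gen v : pres_lift f (gen v) = f v.
Proof. exact/pres_lift_gen/gp_rel_eval. Qed.

End GprodLift.

Lemma gprod_morph_eq (G : groupType) (f g : gprod -> G) :
    {morph f : x y / x * y} -> {morph g : x y / x * y} ->
  (forall v, f (gen v) = g (gen v)) -> f =1 g.
Proof.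
move=> fM gM fg x.
have m1 (h : gprod -> G) : {morph h : x y / x * y} -> h 1 = 1.
  by move=> hM; apply: (mulgI (h 1)); rewrite -hM !mulg1.
have mV (h : gprod -> G) : {morph h : x y / x * y} -> {morph h : x / x^-1}.
  by move=> hM y; apply: (mulgI (h y)); rewrite -hM !mulgV m1.
rewrite -[x]reprK; elim: (repr x) => [|[v b] s IH].
  by rewrite -[\pi _]/(1 : gprod) !m1.
have -> : \pi_(presented gp_rel) ((v, b) :: s) =
    (if b then (gen v)^-1 else gen v) * \pi_(presented gp_rel) s.
  have -> : (if b then (gen v)^-1 else gen v) = \pi_(presented gp_rel) [:: (v, b)].
    case: b => //; apply: (mulgI (gen v)); rewrite mulgV.
    rewrite [RHS]pi_mul; apply/esym/word_congP/asboolP.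
    exact: (word_cong_cancel gp_rel (v, false)).
  by rewrite [RHS]pi_mul.
by rewrite fM gM IH; case: b; rewrite ?(mV f) ?(mV g) // fg.
Qed.

(* A full subgraph Omega is represented by its vertex set. *)
Definition gprod_sub (Omega : {set V}) : set gprod :=
  gen_subgroup [set gen v | v in [set` Omega]]%classic.

(* Viewed as an endomorphism of W; its values lie in W(Omega), see
   [pr_in_sub]. *)
Definition pr (Omega : {set V}) : gprod -> gprod :=
  pres_lift (fun v => if v \in Omega then gen v else 1).

Fact pr_order (Omega : {set V}) v n :
  m v = Some n -> (if v \in Omega then gen v else 1) ^+ n = 1.
Proof. by move=> /gen_order mv; case: ifP => _; rewrite ?expg1n. Qed.

Fact pr_comm (Omega : {set V}) u v (f := fun v => if v \in Omega then gen v else 1) :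
  adj u v -> f u * f v = f v * f u.
Proof.
by move=> /gen_comm uv; rewrite /f; do 2![case: ifP => _]; rewrite ?mulg1 ?mul1g.
Qed.

Fact prM (Omega : {set V}) : {morph pr Omega : x y / x * y}.
Proof. exact: (gprod_liftM (@pr_order Omega) (@pr_comm Omega)). Qed.
HB.instance Definition _ Omega :=
  isMultiplicative.Build gprod gprod (pr Omega) (@prM Omega).

Lemma pr_gen (Omega : {set V}) v :
  pr Omega (gen v) = if v \in Omega then gen v else 1.
Proof. exact: (gprod_lift_gen (@pr_order Omega) (@pr_comm Omega)). Qed.

Definition conjugators (phi : aut gprod) (w : V -> gprod) : Prop :=
  forall v, phi (gen v) = w v * gen v * (w v)^-1.

Definition is_aut0 (phi : aut gprod) : Prop :=
  forall v, exists w : gprod, phi (gen v) = w * gen v * w^-1.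

Definition aut0_pred : pred (aut gprod) := fun phi => `[< is_aut0 phi >].

Record aut0 := Aut0 { aut0_aut :> aut gprod; _ : aut0_pred aut0_aut }.

HB.instance Definition _ := [isSub for aut0_aut].
HB.instance Definition _ := [Choice of aut0 by <:].

Fact aut0_group_closed : group_closed aut0_pred.
Proof.
have a1 (phi : aut gprod) : phi 1 = 1.
  by apply: (mulgI (phi 1)); rewrite -autM !mulg1.
have aV (phi : aut gprod) : {morph phi : x / x^-1}.
  by move=> y; apply: (mulgI (phi y)); rewrite -autM !mulgV a1.
split=> [|f g /asboolP Af /asboolP Ag]; apply/asboolP => v.
  by exists 1; rewrite invg1 mulg1 mul1g.
have [w gv] := Ag v; have [w' fv] := Af v.
exists (f (g^-1 w^-1) * w'); rewrite aut_mulE invgM !mulgA.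
have -> : g^-1 (gen v) = g^-1 w^-1 * gen v * (g^-1 w^-1)^-1.
  apply: (can_inj (aut_invK g).2); rewrite (aut_invK g).1.
  rewrite -aV !autM gv !(aut_invK g).1 invgK.
  by rewrite !mulgA mulVg mul1g mulgVK.
by rewrite !autM fv (aV f) !mulgA.
Qed.

HB.instance Definition _ :=
  SubChoice_isSubGroup.Build (aut gprod) aut0_pred aut0 aut0_group_closed.

Definition star (i : V) : {set V} := [set u | (u == i) || adj i u].

(* Vertex sets of the connected components of the full subgraph on A. *)
Definition components (A : {set V}) : {set {set V}} :=
  [set [set w | connect [rel x y | [&& adj x y, x \in A & y \in A]] u w]
     | u in A].

(* Any such chi is determined by its values on the vertices, and it exists for
   every component K of Gamma minus star i, see [partial_conj_exists]. *)
Definition is_partial_conj (i : V) (K : {set V}) (chi : aut gprod) : Prop :=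
  forall j, chi (gen j) =
    if j \in K then gen i * gen j * (gen i)^-1 else gen j.

Definition partial_conjs (Omega : {set V}) : set (aut gprod) :=
  [set chi | exists i K,
     [/\ i \in Omega, K \in components (~: star i) & is_partial_conj i K chi]]%classic.

(* phi_Omega, computed from conjugators w of phi. *)
Definition phi_map (Omega : {set V}) (w : V -> gprod) (v : V) : gprod :=
  pr Omega (w v) * gen v * (pr Omega (w v))^-1.

Definition extends (f : V -> gprod) (phi : aut gprod) : Prop :=
  forall v, phi (gen v) = f v.

Lemma aut0_conjugators (phi : aut0) : exists w, conjugators phi w.
Proof.
case: phi => phi /= /asboolP H.
by exists (fun v => projT1 (cid (H v))) => v; apply: (projT2 (cid (H v))).
Qed.

Lemma extends_unique f (phi psi : aut gprod) :
  extends f phi -> extends f psi -> phi = psi.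
Proof.
move=> ef eg; apply: autP; apply: gprod_morph_eq; try exact: autM.
by move=> v; rewrite ef eg.
Qed.

Lemma pr_in_sub Omega x : gprod_sub Omega (pr Omega x).
Proof.
have sG := gen_subgroup_is_subgroup [set gen v | v in [set` Omega]]%classic.
case: (sG) => S1 _; have SM := group_closedM sG; have SV := group_closedV sG.
have inS y : (y \in [pred x | x \in gprod_sub Omega]) = `[< gprod_sub Omega y >].
  by [].
have genS v : (if v \in Omega then gen v else 1) \in [pred x | x \in gprod_sub Omega].
  case: ifP => // vO; rewrite inS; apply/asboolP.
  by apply: sub_gen_smallest; exists v.
suff : pr Omega x \in [pred x | x \in gprod_sub Omega] by rewrite inS => /asboolP.
rewrite /pr /pres_lift /word_eval.
apply: (big_ind (fun y => y \in [pred x | x \in gprod_sub Omega])) => //.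
by case=> v [] _ /=; [apply: SV | ]; apply: genS.
Qed.

Lemma partial_conj_exists (adj_sym : symmetric adj) i K :
  K \in components (~: star i) -> exists chi, is_partial_conj i K chi.
Proof.
case/imsetP=> u0 u0A KE.
have KA j : j \in K -> j \in ~: star i.
  rewrite KE inE => /connectP [p]; case/lastP: p => [_ -> //|p y].
  by rewrite rcons_path last_rcons => /andP [_ /= /and3P [_ _ yA]] ->.
have Ki : i \notin K by apply/negP=> /KA; rewrite !inE eqxx.
have out u v : adj u v -> u \in K -> v \notin K -> gen i * gen v = gen v * gen i.
  move=> uv uK; case: (boolP (v \in star i)) => [|vS].
    by rewrite inE => /orP [/eqP -> //|/gen_comm].
  case/negP; move: (uK); rewrite KE !inE => /connect_trans; apply.
  by apply: connect1; rewrite /= uv KA //= finset.in_setC.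
pose f (c : gprod) j := if j \in K then c * gen j * c^-1 else gen j.
have f_order c v n : m v = Some n -> f c v ^+ n = 1.
  move=> /gen_order gv; rewrite /f; case: ifP => _ //.
  have -> : c * gen v * c^-1 = (gen v) ^ c^-1 by rewrite conjgE invgK mulgA.
  by rewrite -conjXg gv conj1g.
have f_comm c u v : (c = gen i \/ c = (gen i)^-1) -> adj u v ->
    f c u * f c v = f c v * f c u.
  move=> cE uv; have gc := gen_comm uv.
  have swap x y : adj x y -> x \in K -> y \notin K ->
      c * gen x * c^-1 * gen y = gen y * (c * gen x * c^-1).
    move=> xy xK yK; have cy : commute (gen i) (gen y) by apply: out xy xK yK.
    have {}cy : commute (gen y) c.
      by case: cE => ->; [|apply: commuteV]; apply: commute_sym.
    apply/esym/commuteM; last exact: commuteV.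
    by apply: commuteM => //; apply/esym/gen_comm.
  rewrite /f; case: (boolP (u \in K)) => uK; case: (boolP (v \in K)) => vK //.
  - have E x : c * x * c^-1 = x ^ c^-1 by rewrite conjgE invgK mulgA.
    by rewrite !E -!conjMg gc.
  - exact: swap.
  - by apply/esym/swap => //; rewrite adj_sym.
pose F c : gprod -> gprod := pres_lift (f c).
have FM c (cE : c = gen i \/ c = (gen i)^-1) : {morph F c : x y / x * y}.
  by apply: gprod_liftM; [apply: f_order | move=> u v; apply: f_comm].
have Fg c (cE : c = gen i \/ c = (gen i)^-1) v : F c (gen v) = f c v.
  by apply: gprod_lift_gen; [apply: f_order | move=> x y; apply: f_comm].
have canF c (cE : c = gen i \/ c = (gen i)^-1) : cancel (F c) (F c^-1).
  have cE' : c^-1 = gen i \/ c^-1 = (gen i)^-1.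
    by case: cE => ->; rewrite ?invgK; [right | left].
  have F1 : F c^-1 1 = 1 by apply: (mulgI (F c^-1 1)); rewrite -FM // !mulg1.
  have FV x : F c^-1 x^-1 = (F c^-1 x)^-1.
    by apply: (mulgI (F c^-1 x)); rewrite -FM // !mulgV F1.
  have Fc : F c^-1 c = c.
    by case: cE cE' FV => -> cE' FV; rewrite ?FV Fg // /f (negbTE Ki).
  apply: (@gprod_morph_eq _ (F c^-1 \o F c) id) => // [x y|v] /=.
    by rewrite !FM.
  rewrite Fg // {1}/f; case: ifP => vK; last by rewrite Fg // /f vK.
  rewrite !FM // FV Fc Fg // /f vK.
  by rewrite invgK !mulgA mulgV mul1g mulgK.
have Ag : `[< is_aut (F (gen i)) >].
  apply/asboolP; split; last by apply: FM; left.
  exists (F (gen i)^-1); first by apply: canF; left.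
  by rewrite -{2}[gen i]invgK; apply: canF; right.
by exists (Aut Ag) => j /=; apply: Fg; left.
Qed.

Lemma gen_partial_conjs_aut0 Omega phi :
  gen_subgroup (partial_conjs Omega) phi -> is_aut0 phi.
Proof.
move=> H; apply/asboolP; apply: (H [set x | aut0_pred x]%classic); split.
  have [a1 aF] := aut0_group_closed.
  split=> [|x y]; rewrite !inE //.
  exact: aF.
move=> chi [i [K [_ _ chiE]]]; apply/asboolP => v; rewrite chiE.
case: ifP => _; first by exists (gen i).
by exists 1; rewrite invg1 mulg1 mul1g.
Qed.

End GraphProduct.

(* Main.v *)
(** Every element [x] of [W] has at each vertex [v] a head [lam v x], the element
  of the cyclic group [<v>] that can be split off on the left of a reduced word
  for [x].  Geometrically, [lam v (g^-1 * x)] records on which side of the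
  hyperplane dual to the coset [g <v>] of the Cayley graph [x] lies.  Heads exist
  because [W] acts on reduced traces.  Two adjacent points are separated by only
  one hyperplane [lam_mulr]; this gives the centralizer of a vertex (the subgroup
  of its star), whence [phi_Omega] is well defined, is an endomorphism, and is
  functorial in [phi] because [pr_Omega o phi = phi_Omega o pr_Omega].

  To see that [phi_Omega] is a product of partial conjugations based in [Omega],
  let [phi v = w v * v * (w v)^-1] with all [w v] in [W(Omega)].  If the
  hyperplane of [phi i] separates [1] from [w j] for some [j] outside the star
  of [i], then it does so in the same way for all [j] in a component of the
  complement of that star; composing [phi] with a power of the partial
  conjugation at [i] rotates these [w j] back and shortens them.  If there is
  no such separation, a ping-pong argument gives [lam i ((w i)^-1 * phi u) =
  lam i u] for all [u], and taking [phi u] to be a vertex yields [phi = 1]. *)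
Require Import Defs.
From HB Require Import structures.
From mathcomp Require Import all_boot.
From mathcomp Require Import boolp classical_sets.

Set Implicit Arguments.
Unset Strict Implicit.
Unset Printing Implicit Defensive.

Local Open Scope quotient_scope.
Local Open Scope group_scope.

(** * Homomorphisms and generated subgroups *)

Section MorphLaws.
Variables (G H : groupType) (f : G -> H).
Hypothesis fM : {morph f : x y / x * y}.

Lemma morph_law1 : f 1 = 1.
Proof. by apply: (mulgI (f 1)); rewrite -fM !mulg1. Qed.

Lemma morph_lawV : {morph f : x / x^-1}.
Proof. by move=> x; apply: (mulgI (f x)); rewrite -fM !mulgV morph_law1. Qed.

End MorphLaws.

Section GenSubgroup.
Variables (G : groupType) (S : set G).

Lemma gen_subgroup1 : gen_subgroup S 1.
Proof.
by case: (gen_subgroup_is_subgroup S) => /asboolP.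
Qed.

Lemma gen_subgroupM x y : gen_subgroup S x -> gen_subgroup S y -> gen_subgroup S (x * y).
Proof.
move=> /asboolP Sx /asboolP Sy; apply/asboolP.
exact: (group_closedM (gen_subgroup_is_subgroup S)).
Qed.

Lemma gen_subgroupV x : gen_subgroup S x -> gen_subgroup S x^-1.
Proof.
move=> /asboolP Sx; apply/asboolP.
exact: (group_closedV (gen_subgroup_is_subgroup S)).
Qed.

End GenSubgroup.

(** * The action of words on reduced traces *)

Section Heaps.
Variables (V : finType) (adj : rel V) (G : groupType).
Hypotheses (adj_sym : symmetric adj) (adj_irr : irreflexive adj).

(* A trace is encoded by its projections to all pairs of non-commuting
   vertices, so that letters at adjacent vertices act on disjoint sets of
   coordinates and hence commute on the nose. *)
Definition heap := V * V -> seq (V * G).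

(** As [adj] is irreflexive, the diagonal pair [(v, v)] is touched by [v], so a syllable is recorded
    even at a vertex adjacent to all others. *)
Definition touches (v : V) (p : V * V) : bool :=
  ((p.1 == v) || (p.2 == v)) && ~~ adj p.1 p.2.

Definition heap0 : heap := fun _ => [::].

Definition heap_cons v c (h : heap) : heap :=
  fun p => if touches v p then (v, c) :: h p else h p.

Definition heap_tail v (h : heap) : heap :=
  fun p => if touches v p then behead (h p) else h p.

Definition exposed v (h : heap) : bool :=
  [forall p, touches v p ==> (ohead (map fst (h p)) == Some v)].

Definition heap_head v (h : heap) : G :=
  if exposed v h then (head (v, 1) (h (v, v))).2 else 1.

Definition heap_add v c h := if c == 1 then h else heap_cons v c h.

Definition push v c h : heap :=
  heap_add v (c * heap_head v h) (if exposed v h then heap_tail v h else h).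

Inductive reduced : heap -> Prop :=
| reduced0 : reduced heap0
| reduced_cons v c h :
    reduced h -> ~~ exposed v h -> c != 1 -> reduced (heap_cons v c h).

Lemma touches_diag v : touches v (v, v).
Proof. by rewrite /touches /= eqxx adj_irr. Qed.

(** A pair touched by both would consist of the distinct vertices [u] and [v], but adjacent pairs
    are never touched. *)
Lemma touches_adj u v p : adj u v -> touches u p -> touches v p = false.
Proof.
move=> uv; case: p => a b; rewrite /touches /= => /andP[ab nab].
rewrite nab andbT; apply/negP => ab'; move: nab.
case/orP: ab => /eqP E; case/orP: ab' => /eqP E'; move: uv;
  by rewrite -E -E' ?adj_irr // => uv; rewrite ?uv // adj_sym uv.
Qed.

Lemma exposed_cons v c h : exposed v (heap_cons v c h).
Proof. by apply/forallP => p; apply/implyP => vp; rewrite /heap_cons vp. Qed.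

Lemma exposed0 v : exposed v heap0 = false.
Proof. by apply/forallP => /(_ (v, v)); rewrite touches_diag. Qed.

Lemma head_cons v c h : heap_head v (heap_cons v c h) = c.
Proof. by rewrite /heap_head exposed_cons /heap_cons touches_diag. Qed.

Lemma tail_cons v c h : heap_tail v (heap_cons v c h) = h.
Proof.
by apply/funext => p; rewrite /heap_tail /heap_cons; case: ifP => // ->.
Qed.

Lemma exposed_cons_adj u v c h :
  adj u v -> exposed v (heap_cons u c h) = exposed v h.
Proof.
move=> uv; apply: eq_forallb => p; rewrite /heap_cons.
by case: ifP => // up; rewrite (touches_adj uv up).
Qed.

Lemma head_cons_adj u v c h :
  adj u v -> heap_head v (heap_cons u c h) = heap_head v h.
Proof.
move=> uv; rewrite /heap_head exposed_cons_adj // /heap_cons.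
by case: ifP => // vv; rewrite adj_sym in uv;
  rewrite (touches_adj uv (touches_diag v)).
Qed.

Lemma cons_comm u v c d h : adj u v ->
  heap_cons u c (heap_cons v d h) = heap_cons v d (heap_cons u c h).
Proof.
move=> uv; apply/funext => p; rewrite /heap_cons.
by case: ifP => // up; rewrite (touches_adj uv up).
Qed.

Lemma exposed_nonadj u v h :
  u != v -> ~~ adj u v -> exposed u h -> exposed v h = false.
Proof.
move=> uv nuv /forallP/(_ (u, v)); rewrite /touches /= eqxx nuv /= => /eqP E.
apply/negP => /forallP/(_ (u, v)); rewrite /touches /= eqxx orbT nuv /= E.
by move=> /eqP[] /eqP; rewrite (negbTE uv).
Qed.

(** The syllables in front of an exposed one are at vertices adjacent to [v], so it moves past them
    to the front. *)
Lemma reduced_exposed v h : reduced h -> exposed v h ->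
  exists c h', [/\ reduced h', ~~ exposed v h', c != 1 & h = heap_cons v c h'].
Proof.
move=> H; elim: H v => {h} [|u c h rh IH uh c1] v; first by rewrite exposed0.
move=> vh; have [<-|uv] := eqVneq u v; first by exists c, h.
have [auv|nuv] := boolP (adj u v); last first.
  by rewrite (exposed_nonadj uv nuv (exposed_cons _ _ _)) in vh.
rewrite exposed_cons_adj // in vh.
have [d [h' [rh' vh' d1 hE]]] := IH _ vh.
exists d, (heap_cons u c h'); split=> //; first 1 last.
- by rewrite exposed_cons_adj.
- by rewrite hE cons_comm.
apply: reduced_cons => //; apply: contra uh.
by rewrite hE exposed_cons_adj // adj_sym.
Qed.

(** A trivial [d] covers the case where [v] is not exposed. In this form [push v c] only replaces
    [d] by [c * d], which yields the laws of the action. *)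
Lemma reduced_split v h : reduced h ->
  exists d h', [/\ reduced h', ~~ exposed v h' & h = heap_add v d h'].
Proof.
move=> rh; have [vh|vh] := boolP (exposed v h).
  have [c [h' [? ? c1 ->]]] := reduced_exposed rh vh.
  by exists c, h'; rewrite /heap_add (negbTE c1).
by exists 1, h; rewrite /heap_add eqxx.
Qed.

Lemma push_add v c d h :
  ~~ exposed v h -> push v c (heap_add v d h) = heap_add v (c * d) h.
Proof.
move=> vh; rewrite /push [heap_add v d h]/heap_add; case: eqP => [->|_].
  by rewrite /heap_head (negbTE vh).
by rewrite exposed_cons head_cons tail_cons.
Qed.

Lemma reduced_add v c h :
  reduced h -> ~~ exposed v h -> reduced (heap_add v c h).
Proof. by rewrite /heap_add; case: eqP => // /eqP c1 rh vh; apply: reduced_cons. Qed.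

Lemma reduced_push v c h : reduced h -> reduced (push v c h).
Proof.
move=> /(reduced_split v)[d [h' [rh vh ->]]].
by rewrite push_add //; apply: reduced_add.
Qed.

Lemma push1 v h : reduced h -> push v 1 h = h.
Proof.
by move=> /(reduced_split v)[d [h' [rh vh ->]]]; rewrite push_add // mul1g.
Qed.

Lemma push_push v c c' h : reduced h -> push v c (push v c' h) = push v (c * c') h.
Proof.
by move=> /(reduced_split v)[d [h' [rh vh ->]]]; rewrite !push_add // mulgA.
Qed.

Lemma exposed_add_adj u v c h :
  adj u v -> exposed v (heap_add u c h) = exposed v h.
Proof. by move=> uv; rewrite /heap_add; case: ifP => // _; apply: exposed_cons_adj. Qed.

Lemma head_add_adj u v c h :
  adj u v -> heap_head v (heap_add u c h) = heap_head v h.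
Proof. by move=> uv; rewrite /heap_add; case: ifP => // _; apply: head_cons_adj. Qed.

Lemma add_comm u v c d h : adj u v ->
  heap_add u c (heap_add v d h) = heap_add v d (heap_add u c h).
Proof.
by move=> uv; rewrite /heap_add; do 2![case: ifP => _] => //; rewrite cons_comm.
Qed.

Lemma push_comm u v c d h : adj u v -> reduced h ->
  push u c (push v d h) = push v d (push u c h).
Proof.
move=> uv; have vu : adj v u by rewrite adj_sym.
move=> /(reduced_split v)[e [h' [/(reduced_split u)[e' [h'' [rh uh ->]]] vh ->]]].
rewrite exposed_add_adj // in vh.
rewrite push_add ?exposed_add_adj // [in LHS]add_comm // push_add ?exposed_add_adj //.
by rewrite [in RHS]add_comm // push_add ?exposed_add_adj // [in RHS]add_comm //
  push_add ?exposed_add_adj // add_comm.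
Qed.

Lemma head_add v c h : ~~ exposed v h -> heap_head v (heap_add v c h) = c.
Proof.
move=> vh; rewrite /heap_add; case: eqP => [->|_]; last exact: head_cons.
by rewrite /heap_head (negbTE vh).
Qed.

Lemma head_push v c h : reduced h -> heap_head v (push v c h) = c * heap_head v h.
Proof.
by move=> /(reduced_split v)[d [h' [rh vh ->]]]; rewrite push_add // !head_add.
Qed.

Lemma head_push_adj u v c h : adj u v -> reduced h ->
  heap_head v (push u c h) = heap_head v h.
Proof.
move=> uv /(reduced_split u)[d [h' [rh vh ->]]].
by rewrite push_add // !head_add_adj.
Qed.

Lemma head_nonadj u v h : u != v -> ~~ adj u v ->
  heap_head u h = 1 \/ heap_head v h = 1.
Proof.
move=> uv nuv; rewrite {1}/heap_head; case: ifP => uh; last by left.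
by right; rewrite /heap_head (exposed_nonadj uv nuv uh).
Qed.

Section WordAction.
Variables (m : V -> option nat) (f : V -> G).
Hypothesis f_order : forall v n, m v = Some n -> f v ^+ n = 1.

Definition heap_act (s : word V) (h : heap) : heap :=
  foldr (fun a => push a.1 (if a.2 then (f a.1)^-1 else f a.1)) h s.

Lemma heap_act_cat s t h : heap_act (s ++ t) h = heap_act s (heap_act t h).
Proof. exact: foldr_cat. Qed.

Lemma reduced_act s h : reduced h -> reduced (heap_act s h).
Proof. by move=> rh; elim: s => //= a s; apply: reduced_push. Qed.

(** Order relations hold by [push_push] and commutations by [push_comm]. Hence the trace of an
    element of the graph product does not depend on the word. *)
Lemma heap_act_cong s t : word_cong (gp_rel adj m) s t ->
  forall h, reduced h -> heap_act s h = heap_act t h.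
Proof.
elim=> {s t} [s t [v n /f_order fn|v v' vv']|[v b]|s s' t t' _ IHs _ IHt|//
  |s t _ IH|s t u _ IH _ IH'] h rh.
- rewrite -[RHS](push1 v) // -{}fn.
  elim: n => [|n IH] in h rh *; first by rewrite expg0 push1.
  by rewrite /= IH // push_push // expgS.
- by rewrite /= push_comm.
- by rewrite /= push_push //; case: b; rewrite /= ?mulVg ?mulgV push1.
- by rewrite !heap_act_cat IHt // IHs //; apply: reduced_act.
- by rewrite IH.
- by rewrite IH // IH'.
Qed.

End WordAction.
End Heaps.

(** * Subgroups of full subgraphs, and heads *)

Section Heads.
Variables (V : finType) (adj : rel V) (m : V -> option nat).
Hypotheses (adj_sym : symmetric adj) (adj_irr : irreflexive adj).

Local Notation W := (gprod adj m).
Local Notation gen := (gen adj m).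

Definition letter v (b : bool) : W := if b then (gen v)^-1 else gen v.

Lemma letter_pi v b : letter v b = \pi_(presented (gp_rel adj m)) [:: (v, b)].
Proof.
case: b => //; apply: (mulgI (gen v)); rewrite mulgV.
rewrite [RHS]pi_mul; apply/esym/word_congP/asboolP.
exact: (word_cong_cancel (gp_rel adj m) (v, false)).
Qed.

Lemma letter_mul_pi v b s : letter v b * \pi_(presented (gp_rel adj m)) s =
  \pi_(presented (gp_rel adj m)) ((v, b) :: s).
Proof. by rewrite letter_pi [LHS]pi_mul. Qed.

Lemma gprod_ind (P : W -> Prop) :
  P 1 -> (forall v b x, P x -> P (letter v b * x)) -> forall x, P x.
Proof.
move=> P1 PM x; rewrite -[x]reprK; elim: (repr x) => [|[v b] s IH].
  exact: P1.
by rewrite -letter_mul_pi; apply: PM.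
Qed.

Lemma pr1 (A : {set V}) : pr A (1 : W) = 1.
Proof. exact: morph_law1 (@prM _ adj m A). Qed.

Lemma prV (A : {set V}) : {morph pr A : x / x^-1 : W}.
Proof. exact: morph_lawV (@prM _ adj m A). Qed.

(** Membership in [W(A)] as being fixed by the retraction, which turns closure properties into
    rewriting; [inW_ind] recovers words over [A]. *)
Definition inW (A : {set V}) (x : W) : Prop := pr A x = x.

Definition cyc v := inW [set v].

Lemma inW1 A : inW A 1.
Proof. by rewrite /inW pr1. Qed.

Lemma inWM A x y : inW A x -> inW A y -> inW A (x * y).
Proof. by rewrite /inW prM => -> ->. Qed.

Lemma inWV A x : inW A x -> inW A x^-1.
Proof. by rewrite /inW prV => ->. Qed.

Lemma pr_letter (A : {set V}) v b : pr A (letter v b) = if v \in A then letter v b else 1.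
Proof. by case: b; rewrite /= ?prV pr_gen; case: ifP; rewrite ?invg1. Qed.

Lemma inW_letter (A : {set V}) v b : v \in A -> inW A (letter v b).
Proof. by rewrite /inW pr_letter => ->. Qed.

Lemma cyc_letter v b : cyc v (letter v b).
Proof. by apply: inW_letter; rewrite inE. Qed.

Lemma inW_pr A x : inW A (pr A x).
Proof.
elim/gprod_ind: x => [|v b x IH]; first by rewrite pr1; apply: inW1.
rewrite prM pr_letter; case: ifP => vA; last by rewrite mul1g.
by apply: inWM => //; apply: inW_letter.
Qed.

Lemma inW_ind (A : {set V}) (P : W -> Prop) : P 1 ->
  (forall v b x, v \in A -> inW A x -> P x -> P (letter v b * x)) ->
  forall x, inW A x -> P x.
Proof.
move=> P1 PM x <-; elim/gprod_ind: x => [|v b x IH]; first by rewrite pr1.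
rewrite prM pr_letter; case: ifP => vA; last by rewrite mul1g.
by apply: PM => //; apply: inW_pr.
Qed.

Lemma inW_sub (A B : {set V}) x : A \subset B -> inW A x -> inW B x.
Proof.
move=> /fintype.subsetP AB; elim/inW_ind=> [|v b y vA _ By]; first exact: inW1.
by apply: inWM => //; apply/inW_letter/AB.
Qed.

Lemma cyc_inW (A : {set V}) v c : v \in A -> cyc v c -> inW A c.
Proof. by move=> vA; apply: inW_sub; rewrite finset.sub1set. Qed.

Lemma commute_inW (A : {set V}) x y :
  (forall v, v \in A -> commute y (gen v)) -> inW A x -> commute y x.
Proof.
move=> H; elim/inW_ind=> [|v b z vA _ yz]; first exact: commute1.
by apply: commuteM => //; case: b; [apply: commuteV|]; apply: H.
Qed.

Lemma commute_inW2 (A B : {set V}) x y :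
    (forall u v, u \in A -> v \in B -> commute (gen u) (gen v)) ->
  inW A x -> inW B y -> commute x y.
Proof.
move=> H Ax By; apply: commute_inW By => v vB.
by apply/commute_sym; apply: commute_inW Ax => u uA; apply/commute_sym/H.
Qed.

Lemma cycC v c d : cyc v c -> cyc v d -> commute c d.
Proof.
by apply: commute_inW2 => u u'; rewrite !inE => /eqP -> /eqP ->.
Qed.

Lemma commute_star v c x : cyc v c -> inW (star adj v) x -> commute c x.
Proof.
apply: commute_inW2 => u u'; rewrite !inE => /eqP -> /orP[/eqP -> //|vu].
exact: gen_comm.
Qed.

(** Syllables take values in [W] itself rather than in separate cyclic groups, so that heads
    multiply with elements of [W]. *)
Definition heap_of (x : W) : heap V W := heap_act adj gen (repr x) (@heap0 V W).

Definition lam v (x : W) : W := heap_head adj v (heap_of x).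

Lemma reduced_heap_of x : reduced adj (heap_of x).
Proof. by apply: reduced_act => //; apply: reduced0. Qed.

Lemma heap_of_pi s :
  heap_of (\pi_(presented (gp_rel adj m)) s) = heap_act adj gen s (@heap0 V W).
Proof.
apply: (@heap_act_cong _ adj _ adj_sym adj_irr m) (word_cong_repr _ _) _ _.
  exact: gen_order.
exact: reduced0.
Qed.

Lemma heap_of_letter v b x :
  heap_of (letter v b * x) = push adj v (letter v b) (heap_of x).
Proof. by rewrite -[x in LHS]reprK letter_mul_pi heap_of_pi. Qed.

Lemma lam1 v : lam v 1 = 1.
Proof. by rewrite /lam heap_of_pi /= /heap_head exposed0. Qed.

Lemma lam_mul v c x : cyc v c -> lam v (c * x) = c * lam v x.
Proof.
elim/inW_ind=> [|u b y]; first by rewrite !mul1g.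
rewrite inE => /eqP -> _ IH; rewrite -!mulgA -IH /lam heap_of_letter.
by rewrite head_push //; apply: reduced_heap_of.
Qed.

Lemma lam_mul_adj u v c x : adj u v -> cyc u c -> lam v (c * x) = lam v x.
Proof.
move=> uv; elim/inW_ind=> [|u' b y]; first by rewrite !mul1g.
rewrite inE => /eqP -> _ IH; rewrite -!mulgA -IH /lam heap_of_letter.
by rewrite head_push_adj //; apply: reduced_heap_of.
Qed.

Lemma lam_nonadj u v x : u != v -> ~~ adj u v -> lam u x <> 1 -> lam v x = 1.
Proof. by move=> uv nuv; have [] := head_nonadj (heap_of x) uv nuv. Qed.

(** Reduced words over [A]: [lam v x = 1] says that the syllable [c] has nothing in [x] to merge
    with. *)
Inductive geodesic (A : {set V}) : W -> Prop :=
| geodesic1 : geodesic A 1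
| geodesicM v c x : v \in A -> cyc v c -> c <> 1 -> lam v x = 1 ->
    geodesic A x -> geodesic A (c * x).

Lemma geodesic_lam_cyc A x v : geodesic A x -> cyc v (lam v x).
Proof.
elim=> {x} [|u c x _ cc c1 ux _ IH]; first by rewrite lam1; apply: inW1.
have [<-|uv] := eqVneq u v; first by rewrite lam_mul // ux mulg1.
have [auv|nuv] := boolP (adj u v); first by rewrite (lam_mul_adj x auv).
by rewrite (@lam_nonadj u v) //; [apply: inW1 | rewrite lam_mul // ux mulg1].
Qed.

(** The head is the first syllable, or commutes past it, or is trivial because the first syllable
    blocks it. *)
Lemma geodesic_pop A x v : geodesic A x -> geodesic A ((lam v x)^-1 * x).
Proof.
elim=> {x} [|u c x uA cc c1 ux gx IH].
  by rewrite lam1 invg1 mul1g; apply: geodesic1.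
have [<-|uv] := eqVneq u v; first by rewrite lam_mul // ux mulg1 mulKg.
have cu : lam u (c * x) = c by rewrite lam_mul // ux mulg1.
have [auv|nuv] := boolP (adj u v); last first.
  rewrite (@lam_nonadj u v) ?cu // invg1 mul1g.
  exact: (geodesicM uA).
have cv := geodesic_lam_cyc v gx.
have avu : adj v u by rewrite adj_sym.
have com : commute c (lam v x)^-1.
  apply/commuteV; apply: (@commute_star u) => //; apply: cyc_inW cv.
  by rewrite !inE auv orbT.
rewrite (lam_mul_adj x auv) // mulgA -com -mulgA; apply: (geodesicM uA) => //.
by rewrite (lam_mul_adj x avu) //; apply: inWV.
Qed.

Lemma geodesic_mul (A : {set V}) x v c :
  v \in A -> cyc v c -> geodesic A x -> geodesic A (c * x).
Proof.
move=> vA cc gx; have cv := geodesic_lam_cyc v gx.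
rewrite -[x](mulVKg (lam v x)) mulgA.
have [->|/eqP c1] := eqVneq (c * lam v x) 1.
  by rewrite mul1g; apply: geodesic_pop.
apply: (geodesicM vA) => //; first exact: inWM.
  by rewrite lam_mul ?mulVg //; apply: inWV.
exact: geodesic_pop.
Qed.

Lemma inW_geodesic A x : inW A x -> geodesic A x.
Proof.
elim/inW_ind=> [|v b y vA _]; first exact: geodesic1.
exact: (geodesic_mul vA (cyc_letter v b)).
Qed.

Lemma geodesicT x : geodesic [set: V] x.
Proof.
elim/gprod_ind: x => [|v b y]; first exact: geodesic1.
by apply: (geodesic_mul _ (cyc_letter v b)); rewrite inE.
Qed.

Lemma lam_cyc v x : cyc v (lam v x).
Proof. exact: geodesic_lam_cyc (geodesicT x). Qed.

Lemma lam_notin (A : {set V}) v x : v \notin A -> inW A x -> lam v x = 1.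
Proof.
move=> vA /inW_geodesic; elim=> {x} [|u c x uA cc c1 ux _ IH]; first exact: lam1.
have uv : u != v by apply: contraNneq vA => <-.
have [auv|nuv] := boolP (adj u v); first by rewrite (lam_mul_adj x auv).
by apply: (@lam_nonadj u v) => //; rewrite lam_mul // ux mulg1.
Qed.

(* Adjacent vertices of the Cayley graph are separated by a single hyperplane,
   whose carrier contains them. *)
Lemma lam_mulr i k g c : cyc k c -> lam i (g * c) <> lam i g ->
  i = k /\ inW (star adj i) g.
Proof.
move=> ck; have := geodesicT g => gg; elim: gg i => {g} [|u d g _ cd d1 ug _ IH] i.
  rewrite mul1g lam1 => H; split; last exact: inW1.
  apply/eqP/negPn/negP => ik; apply: H.
  by apply: (@lam_notin [set k]) => //; rewrite inE.
have [ui|ui] := eqVneq u i.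
  rewrite {}ui in cd ug *.
  rewrite -mulgA [lam i (d * (g * c))]lam_mul // [lam i (d * g)]lam_mul // => H.
  have [|ik ig] := IH i; first by move=> E; apply: H; rewrite E.
  split=> //; apply: (inWM _ ig); apply: cyc_inW cd; by rewrite inE eqxx.
have [aui|nui] := boolP (adj u i).
  rewrite -mulgA (lam_mul_adj (g * c) aui) // (lam_mul_adj g aui) // => /IH[ik ig].
  split=> //; apply: (inWM _ ig); apply: cyc_inW cd; by rewrite inE adj_sym aui orbT.
(* The syllable [d] hides [i]. A change at [i] requires [c] to cancel [d]; what remains is [g], in
   the subgroup of the star of [u], whose head at [i] is trivial. *)
have du : lam u (d * g) <> 1 by rewrite lam_mul // ug mulg1.
rewrite (@lam_nonadj u i (d * g)) // => gc1.
have [uc|uc] := pselect (lam u (d * g * c) = 1); last first.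
  by case: gc1; apply: lam_nonadj uc.
rewrite -mulgA lam_mul // in uc.
have uE : lam u (g * c) = d^-1 by apply: (mulgI d); rewrite uc mulgV.
have [|uk sg] := IH u.
  by rewrite ug uE -invg1 => /invg_inj.
rewrite -uk in ck; have cg : commute c g := commute_star ck sg.
case: gc1; rewrite -mulgA -cg mulgA.
have -> : d * c = 1 by move: uc; rewrite -cg lam_mul // ug mulg1.
rewrite mul1g; apply: lam_notin sg.
by rewrite !inE negb_or eq_sym ui.
Qed.

(** A path from [g] to [g * a] with letters in [A] crosses only hyperplanes labelled in [A]. *)
Lemma lam_mulr_out (A : {set V}) i g a : i \notin A -> inW A a -> lam i (g * a) = lam i g.
Proof.
move=> iA Aa; elim/inW_ind: Aa g => [|v b x vA _ IH] g; first by rewrite mulg1.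
rewrite mulgA IH; apply: contrapT => /(lam_mulr (cyc_letter v b))[iv _].
by rewrite iv vA in iA.
Qed.

Lemma lam_inW (A : {set V}) i g a : inW A a -> lam i (g * a) <> lam i g -> i \in A.
Proof. by move=> Aa ga; apply/negPn/negP => iA; apply: ga; apply: lam_mulr_out Aa. Qed.

(** * Centralizers of vertices *)

Hypothesis m_order : order_map m.

(* In the proof [e s] counts each letter [v] as 1 and each inverse as [p.-1];
   modulo a prime [p] dividing the order of [v], this is an invariant of the
   group element. *)
Lemma gen_neq1 v : gen v <> 1.
Proof.
have [p p1 pm] : exists2 p, (1 < p)%N & forall n, m v = Some n -> (p %| n)%N.
  (* In infinite order the divisibility condition is vacuous and any modulus above 1 serves. *)
  case mv: (m v) => [n|]; last by exists 2.
  have [p [a [pp a0 ->]]] := m_order mv.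
  exists p; first exact: prime_gt1.
  by move=> _ [<-]; rewrite -{1}[p]expn1; apply: dvdn_exp2l.
pose e (s : word V) := (\sum_(a <- s) (a.1 == v) * (if a.2 then p.-1 else 1))%N.
have eE s t : word_cong (gp_rel adj m) s t -> (e s = e t %[mod p])%N.
  elim=> {s t} [s t []|[u b]|s s' t t' _ IHs _ IHt|//|s t _ ->//|s t u _ -> _ ->//].
  - move=> u n un; rewrite /e big_nil big_nseq iter_addn_0 mod0n /= muln1.
    case: eqP un => [->|_ _]; last by rewrite mod0n.
    by move=> /pm; rewrite mul1n /dvdn => /eqP.
  - by move=> u u' _; rewrite /e !big_cons !big_nil addnCA.
  - rewrite /e !big_cons big_nil addn0 /= -mulnDr.
    suff -> : ((if b then p.-1 else 1) + (if ~~ b then p.-1 else 1) = p)%N.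
      by rewrite modnMl mod0n.
    by case: b; rewrite /= ?addn1 ?add1n prednK // ltnW.
  - by rewrite /e !big_cat /= -!/(e _) -modnDm IHs IHt modnDm.
move=> /word_congP/asboolP/eE; rewrite /e big_nil big_seq1 /= eqxx muln1.
by rewrite mod0n modn_small.
Qed.

(** Right multiplication of [x] by [v] equals left multiplication, which changes the head at [v]; so
    [x] lies in the carrier of the hyperplane crossed. *)
Lemma centralizer_gen v x : commute x (gen v) -> inW (star adj v) x.
Proof.
move=> xv; have cv : cyc v (gen v) := cyc_letter v false.
suff /(lam_mulr cv)[] : lam v (x * gen v) <> lam v x by [].
rewrite xv lam_mul // => E; apply: (@gen_neq1 v).
by apply: (mulIg (lam v x)); rewrite E mul1g.
Qed.

(** * Syllable length and separation by hyperplanes *)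

Inductive syllables : nat -> W -> Prop :=
| syllables0 : syllables 0 1
| syllablesS n v c x : cyc v c -> syllables n x -> syllables n.+1 (c * x).

Lemma exists_syllables x : exists n, `[< syllables n x >].
Proof.
elim/gprod_ind: x => [|v b x [n /asboolP nx]].
  by exists 0; apply/asboolP; apply: syllables0.
by exists n.+1; apply/asboolP/(syllablesS (cyc_letter v b)).
Qed.

Definition len x : nat := ex_minn (exists_syllables x).

Lemma len_syllables x : syllables (len x) x.
Proof. by rewrite /len; case: ex_minnP => n /asboolP. Qed.

Lemma len_min n x : syllables n x -> (len x <= n)%N.
Proof. by move=> nx; rewrite /len; case: ex_minnP => k _; apply; apply/asboolP. Qed.

(* If a hyperplane separates [1] from [z], then rotating [z] about it to the
   side of [1] removes a crossing from any path joining [1] to [z]. *)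
Lemma syllables_unfold n i g z : syllables n z -> lam i (g * z) <> lam i g ->
  exists2 k, (k < n)%N &
    syllables k (g^-1 * (lam i (g * z) * (lam i g)^-1)^-1 * g * z).
Proof.
move=> nz; elim: nz g => {n z} [|n v c z cc nz IH] g.
  by rewrite mulg1.
have [gc|/eqP gc] := eqVneq (lam i (g * c)) (lam i g).
  rewrite -gc [g * (c * z)]mulgA => /IH[k kn kz]; exists k.+1 => //.
  by have := syllablesS cc kz; rewrite invgM !mulgA mulgV mul1g.
move=> gz; have [iv sg] := lam_mulr cc gc; rewrite -{}iv in cc.
have cg : commute c g := commute_star cc sg.
have gcz : lam i (g * (c * z)) = c * lam i (g * z).
  by rewrite mulgA -cg -mulgA; apply: lam_mul.
(* The edge [c] crosses the hyperplane. If [z] makes no net crossing, the rotation just deletes [c];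
   otherwise it undoes [c] and then unfolds [z] by induction. *)
have [E|/eqP NE] := eqVneq (lam i (g * z)) (lam i g).
  exists n => //; rewrite gcz E mulgK -!mulgA.
  by rewrite [g * _]mulgA -cg -!mulgA !mulKg.
have [k kn kz] := IH _ NE; exists k; first exact: ltnW.
move: kz; rewrite gcz -[c * _ * _]mulgA; set t := lam i (g * z) / lam i g.
by rewrite [(c * t)^-1]invgM -!mulgA [g * (c * z)]mulgA -cg -[c * g * z]mulgA mulKg.
Qed.

Lemma len_unfold i g z : lam i (g * z) <> lam i g ->
  (len (g^-1 * (lam i (g * z) * (lam i g)^-1)^-1 * g * z)%g < len z)%N.
Proof.
by move=> /(syllables_unfold (len_syllables z))[k kz /len_min/leq_ltn_trans]; apply.
Qed.

(* Two hyperplanes labelled by non-adjacent vertices, neither of which separates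
   [1] from the other, have disjoint far sides. *)
Lemma lam_disjoint i k g y : i != k -> ~~ adj i k ->
  lam i g = 1 -> lam k g^-1 = 1 -> lam k y = 1 \/ lam i (g * y) = 1.
Proof.
(* Induction on the inverse extends [y] on the right, so that each step crosses at most one
   hyperplane. *)
move=> ik nik gi gk; rewrite -[y]invgK; elim/gprod_ind: y^-1 => [|v b x IH].
  by rewrite invg1 lam1; left.
rewrite invgM; set z := x^-1 in IH *; set c := _^-1.
have cc : cyc v c by apply/inWV/cyc_letter.
(* A step that changes the head at [k] stays in the subgroup of the star of [k]; this star omits
   [i], so the head at [i] is still that of [g]. The other case is symmetric. *)
have [kz|kz] := pselect (lam k (z * c) = lam k z); last first.
  right; have [kv kS] := lam_mulr cc kz.
  rewrite -gi; apply: (@lam_mulr_out (star adj k)).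
    by rewrite !inE negb_or ik adj_sym nik.
  by apply: inWM kS _; apply: cyc_inW cc; rewrite -kv inE eqxx.
have [iz|iz] := pselect (lam i (g * z * c) = lam i (g * z)).
  by rewrite kz mulgA iz.
left; have [iv iS] := lam_mulr cc iz.
rewrite -gk -[z * c](mulKg g); apply: (@lam_mulr_out (star adj i)).
  by rewrite !inE negb_or eq_sym ik nik.
by rewrite mulgA; apply: inWM iS _; apply: cyc_inW cc; rewrite -iv inE eqxx.
Qed.

(** * Conjugators of an automorphism *)

Lemma inW_pr_inW (A B : {set V}) x : inW A x -> inW A (pr B x).
Proof.
elim/inW_ind=> [|v b y vA _ Ay]; first by rewrite pr1; apply: inW1.
rewrite prM pr_letter; apply: inWM Ay; case: ifP => _; last exact: inW1.
exact: inW_letter.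
Qed.

Lemma star_sym u v : (v \in star adj u) = (u \in star adj v).
Proof. by rewrite !inE eq_sym adj_sym. Qed.

Lemma gen_star_commute u x : inW (star adj u) x -> commute (gen u) x.
Proof. exact: (commute_star (cyc_letter u false)). Qed.

(** The conjugate of [v] centralizes [u], so the retraction [p] onto the subgroup of the star of [u]
    fixes it. Thus [g] and [p g] conjugate [v] alike and differ by an element centralizing [v]. *)
Lemma conj_commute_split u v g : adj u v ->
    commute (gen u) (g * gen v * g^-1) ->
  exists a b, [/\ inW (star adj u) a, inW (star adj v) b & g = a * b].
Proof.
move=> uv /commute_sym/centralizer_gen; pose p : W -> W := pr (star adj u) => pE.
have vu : p (gen v) = gen v by rewrite /p pr_gen inE uv orbT.
exists (p g), ((p g)^-1 * g); split; last by rewrite mulVKg.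
  exact: inW_pr.
apply: centralizer_gen; move: pE; rewrite /inW !prM prV -/p vu => E.
by apply: (mulgI (p g)); rewrite !mulgA mulgV mul1g E mulgVK.
Qed.

Lemma conj_cyc (phi : aut W) w v c : conjugators phi w -> cyc v c ->
  phi c = w v * c * (w v)^-1.
Proof.
move=> cw; elim/inW_ind=> [|u b x].
  by rewrite (morph_law1 (autM phi)) mulg1 mulgV.
rewrite inE => /eqP -> _ IH; rewrite autM IH.
have -> : phi (letter v b) = w v * letter v b * (w v)^-1.
  case: b => /=; last exact: cw.
  by rewrite (morph_lawV (autM phi)) cw !invgM invgK mulgA.
by rewrite !mulgA mulgVK.
Qed.

Lemma conjugators_split (phi : aut W) w u v : conjugators phi w -> adj u v ->
  exists a b, [/\ inW (star adj u) a, inW (star adj v) b & w v = w u * a * b].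
Proof.
move=> cw uv.
have [|a [b [ua vb E]]] := @conj_commute_split u v ((w u)^-1 * w v) uv.
  have := congr1 phi (gen_comm m uv); rewrite !autM !cw => H.
  apply: (mulgI (w u)); apply: (mulIg (w u)^-1).
  by move: H; rewrite !invgM invgK !mulgA !mulgV mul1g => ->; rewrite mulgK.
by exists a, b; split=> //; rewrite -mulgA -E mulVKg.
Qed.

Lemma lam_star_mul i a y : inW (star adj i) a -> lam i (a * y) = lam i a * lam i y.
Proof.
elim/inW_ind=> [|v b x vi _ IH]; first by rewrite lam1 !mul1g.
rewrite -mulgA; move: vi; rewrite inE => /orP[/eqP ->|iv].
  by rewrite !(lam_mul _ (cyc_letter i b)) IH mulgA.
by rewrite adj_sym in iv; rewrite !(lam_mul_adj _ iv (cyc_letter v b)) IH.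
Qed.

(* Ping-pong: if no hyperplane of [phi v_i] separates [1] from that of [phi v_j]
   then [phi u] lies on the same side of the hyperplane of [phi v_i] as [u] of
   that of [v_i]. *)
Lemma lam_conjugated (phi : aut W) w : conjugators phi w ->
    (forall i, lam i (w i)^-1 = 1) ->
    (forall i j, j \notin star adj i -> lam i ((w i)^-1 * w j) = 1) ->
  forall u i, lam i ((w i)^-1 * phi u) = lam i u.
Proof.
move=> cw w1 w2 u; elim: (geodesicT u) => {u} [|k c u _ cc c1 ku _ IH] i.
  by rewrite (morph_law1 (autM phi)) mulg1 w1 lam1.
have Ek : lam k ((w k)^-1 * phi (c * u)) = lam k (c * u).
  by rewrite autM (conj_cyc cw cc) !mulgA mulVg mul1g -mulgA !(lam_mul _ cc) IH.
have [<-//|ki] := eqVneq k i.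
have [aki|nki] := boolP (adj k i).
  rewrite (lam_mul_adj u aki cc) -IH autM (conj_cyc cw cc).
  have aik : adj i k by rewrite adj_sym.
  have [a [b [ia kb wk]]] := conjugators_split cw aik.
  (* Seen from [w i], [phi c] acts as [c] conjugated by [a]: the contributions of [a] and its
     inverse to the head at [i] cancel, and [c] makes none. *)
  have -> : (w i)^-1 * (w k * c * (w k)^-1 * phi u) =
      a * (c * (a^-1 * ((w i)^-1 * phi u))).
    have E : b * c = c * b by apply/esym/(commute_star cc).
    by rewrite wk !invgM -!mulgA mulKg [b * (c * _)]mulgA E -!mulgA mulVKg.
  rewrite (lam_star_mul _ ia) (lam_mul_adj _ aki cc) (lam_star_mul _ (inWV ia)).
  by rewrite mulgA -(lam_star_mul _ ia) mulgV lam1 mul1g.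
have nik : ~~ adj i k by rewrite adj_sym.
have kcu : lam k (c * u) <> 1 by rewrite (lam_mul _ cc) ku mulg1.
rewrite (lam_nonadj ki nki kcu).
have ik : i != k by rewrite eq_sym.
(* The point [phi (c * u)] is beyond the hyperplane of [phi k], hence not beyond the disjoint one of
   [phi i]. *)
have [||E|] := @lam_disjoint i k ((w i)^-1 * w k) ((w k)^-1 * phi (c * u)) ik nik.
- by apply: w2; rewrite !inE negb_or ki.
- by rewrite invgM invgK; apply: w2; rewrite !inE negb_or ik.
- by case: kcu; rewrite -Ek.
- by rewrite mulgA mulgK.
Qed.

Lemma lam_eq1 x : (forall i, lam i x = 1) -> x = 1.
Proof.
case: (geodesicT x) => // v c y _ cc c1 vy _ /(_ v).
by rewrite (lam_mul _ cc) vy mulg1.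
Qed.

Lemma unseparated_fixes (phi : aut W) w : conjugators phi w ->
    (forall i j, j \notin star adj i -> lam i ((w i)^-1 * w j) = lam i (w i)^-1) ->
  forall j, phi (gen j) = gen j.
Proof.
(* A factor in the cyclic group of [i] keeps [w i] a conjugator; this one makes the head of its
   inverse at [i] trivial. *)
move=> cw sep j; pose w' i := w i * lam i (w i)^-1.
have cw' : conjugators phi w'.
  move=> v; rewrite cw /w' invgM -!mulgA; congr (_ * _).
  rewrite [RHS]mulgA (cycC (lam_cyc v _) (cyc_letter v false)) /=.
  by rewrite -mulgA mulVKg.
have w1 i : lam i (w' i)^-1 = 1.
  by rewrite /w' invgM (lam_mul _ (inWV (lam_cyc i _))) mulVg.
have w2 i k : k \notin star adj i -> lam i ((w' i)^-1 * w' k) = 1.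
  move=> ki; rewrite /w' invgM -mulgA (lam_mul _ (inWV (lam_cyc i _))) mulgA.
  rewrite (@lam_mulr_out [set k]) ?sep ?mulVg //; last exact: lam_cyc.
  by move: ki; rewrite !inE negb_or eq_sym => /andP[].
have L := lam_conjugated cw' w1 w2.
(* If the edge from [1] to [gen j] crosses the hyperplane of [phi i], then [i = j] and [w' i]
   centralizes it. If it crosses none of these, the preimage of [gen j] has only trivial heads, so
   [gen j] would be trivial. *)
have [[i ij]|no] := pselect (exists i, lam i ((w' i)^-1 * gen j) <> 1).
  rewrite -(w1 i) in ij; have [iE] := lam_mulr (cyc_letter j false) ij.
  by rewrite iE => /inWV; rewrite invgK cw' => /gen_star_commute <-; rewrite mulgK.
case: (@gen_neq1 j); rewrite -[LHS](aut_invK phi).1.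
rewrite (_ : aut_inv phi (gen j) = 1) ?(morph_law1 (autM phi)) //.
apply: lam_eq1 => i; rewrite -L (aut_invK phi).1.
by apply: contrapT => E; apply: no; exists i.
Qed.


(** * Components and products of partial conjugations *)

Local Notation component_rel A := [rel x y | [&& adj x y, x \in A & y \in A]].

Lemma componentP (A K : {set V}) u : K \in components adj A -> u \in K ->
  u \in A.
Proof.
case/imsetP=> u0 u0A ->; rewrite inE => /connectP[p]; case/lastP: p => [_ -> //|p y].
by rewrite rcons_path last_rcons => /andP[_ /= /and3P[_ _ yA]] ->.
Qed.

Lemma mem_component (A : {set V}) u : u \in A ->
  exists2 K, K \in components adj A & u \in K.
Proof.
move=> uA; exists [set w | connect (component_rel A) u w]; last by rewrite inE connect0.
by apply/imsetP; exists u.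
Qed.

Lemma component_const (T : Type) (f : V -> T) (A K : {set V}) :
    (forall x y, adj x y -> x \in A -> y \in A -> f x = f y) ->
  K \in components adj A -> forall x y, x \in K -> y \in K -> f x = f y.
Proof.
move=> fA /imsetP[u uA ->].
suff H x : connect (component_rel A) u x -> f x = f u.
  by move=> x y; rewrite !inE => /H -> /H ->.
case/connectP=> p; elim: p u {uA} => [|z p IH] u /=; first by move=> _ ->.
move=> /andP[/and3P[uz uA zA] /IH H /H ->].
by apply/esym/fA.
Qed.

(** A power of the partial conjugation works, because that automorphism fixes [gen i]: [i] lies
    outside [K]. *)
Lemma partial_conj_cyc (Omega : {set V}) i K t :
    i \in Omega -> K \in components adj (~: star adj i) -> cyc i t ->
  exists chi : aut W, gen_subgroup (partial_conjs Omega) chi /\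
    forall j, chi (gen j) = if j \in K then t * gen j * t^-1 else gen j.
Proof.
move=> iO KC.
have iK : i \notin K by apply/negP => /(componentP KC); rewrite !inE eqxx.
have [chi1 chi1E] := partial_conj_exists m adj_sym KC.
have chi1S : gen_subgroup (partial_conjs Omega) chi1.
  by apply: sub_gen_smallest; exists i, K.
have [chi1V] : exists chi : aut W, gen_subgroup (partial_conjs Omega) chi /\
    forall j, chi (gen j) = if j \in K then (gen i)^-1 * gen j * gen i else gen j.
  exists chi1^-1; split=> [|j]; first exact: gen_subgroupV.
  apply: (can_inj (aut_invK chi1).2); rewrite (aut_invK chi1).1.
  case: ifP => jK; last by rewrite chi1E jK.
  rewrite !autM (morph_lawV (autM chi1)) !chi1E (negbTE iK) jK.
  by rewrite !mulgA mulVg mul1g mulgVK.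
move=> [chi1VS chi1VE].
elim/inW_ind=> [|v b x].
  exists 1; split=> [|j]; first exact: gen_subgroup1.
  by rewrite aut_oneE mul1g invg1 mulg1; case: ifP.
rewrite inE => /eqP -> _ [chi [chiS chiE]].
have chii : chi (gen i) = gen i by rewrite chiE (negbTE iK).
have chiiV : chi (gen i)^-1 = (gen i)^-1 by rewrite (morph_lawV (autM chi)) chii.
exists (chi * (if b then chi1V else chi1)); split=> [|j].
  by apply: gen_subgroupM => //; case: b.
rewrite aut_mulE; case: b => /=; rewrite ?chi1E ?chi1VE; case: ifP => jK;
  rewrite ?autM ?chii ?chiiV chiE jK //.
  by rewrite invgM invgK !mulgA.
by rewrite invgM !mulgA.
Qed.

Lemma conj_in_gen_partial_conjs (Omega : {set V}) (phi : aut W) w :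
    conjugators phi w -> (forall j, inW Omega (w j)) ->
  gen_subgroup (partial_conjs Omega) phi.
Proof.
have [n] := ubnP (\sum_j len (w j))%N; elim: n phi w => // n IH phi w nw cw Ow.
have [[i [j [ji]]]|no] := pselect (exists i j, j \notin star adj i /\
    lam i ((w i)^-1 * w j) <> lam i (w i)^-1); last first.
  have -> : phi = 1; last exact: gen_subgroup1.
  apply: autP; apply: gprod_morph_eq => [||v]; try exact: autM.
  apply: (unseparated_fixes cw) => i j ji; apply: contrapT => E.
  by apply: no; exists i, j.
move=> sep; have iO := lam_inW (Ow j) sep.
have [K KC jK] : exists2 K, K \in components adj (~: star adj i) & j \in K.
  by apply: mem_component; rewrite finset.in_setC.
(* Conjugators at adjacent [x], [y] differ by factors from the subgroups of their stars, neither of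
   which contains [i]. *)
have Kconst l : l \in K -> lam i ((w i)^-1 * w l) = lam i ((w i)^-1 * w j).
  move=> lK; apply: (component_const (f := fun l => lam i ((w i)^-1 * w l)) _ KC) => //.
  move=> x y xy; rewrite !finset.in_setC => xi yi.
  have [a [b [xa yb ->]]] := conjugators_split cw xy.
  by rewrite !mulgA (lam_mulr_out _ _ yb) ?(lam_mulr_out _ _ xa) // star_sym.
pose t := lam i ((w i)^-1 * w j) * (lam i (w i)^-1)^-1.
have ct : cyc i t by apply: inWM; [|apply: inWV]; apply: lam_cyc.
have [chi [chiS chiE]] := partial_conj_cyc iO KC (inWV ct).
(* Conjugators of [phi * chi]: the new factor is [phi t^-1], the rotation to which [len_unfold]
   applies. *)
pose w' l := if l \in K then w i * t^-1 * (w i)^-1 * w l else w l.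
rewrite -[phi](mulgK chi); apply: gen_subgroupM; last exact: gen_subgroupV.
have shorter l : l \in K -> (len (w' l) < len (w l))%N.
  move=> lK; rewrite /w' lK; have := @len_unfold i (w i)^-1 (w l).
  by rewrite (Kconst _ lK) invgK; apply.
apply: (IH _ w').
- apply: leq_trans (_ : (\sum_j len (w j) <= n)%N) => //.
  rewrite (bigD1 j) //= [X in (_ < X)%N](bigD1 j) //= -addSn leq_add ?shorter //.
  apply: leq_sum => l _; have [lK|lK] := boolP (l \in K); first exact/ltnW/shorter.
  by rewrite /w' (negbTE lK).
- move=> l; rewrite aut_mulE chiE /w'; case: ifP => _; last exact: cw.
  rewrite !autM (conj_cyc cw (inWV ct)) (conj_cyc cw (inWV (inWV ct))) cw.
  by rewrite !invgM !invgK !mulgA.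
- move=> l; rewrite /w'; case: ifP => _ //.
  by do ![apply: inWM] => //; apply: inWV => //; apply: cyc_inW ct.
Qed.

(** * The retraction onto the subgroup generated by partial conjugations *)

Lemma conjugators_inj (phi : aut W) (Omega : {set V}) w w' :
    conjugators phi w -> conjugators phi w' ->
  phi_map Omega w =1 phi_map Omega w'.
Proof.
move=> cw cw' v; have : inW (star adj v) ((w v)^-1 * w' v).
  apply: centralizer_gen; apply: (mulgI (w v)); apply: (mulIg (w' v)^-1).
  by rewrite !mulgA mulgV mul1g -cw' mulgK -cw.
(* Projection keeps the quotient of the conjugators in the subgroup of the star of [v], so it still
   centralizes [v]. *)
move=> /(inW_pr_inW Omega)/gen_star_commute.
rewrite prM prV /phi_map; set p := pr _ _; set q := pr _ _ => E.
apply: (mulgI p^-1); apply: (mulIg q); rewrite !mulgA mulVg mul1g mulgVK.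
by rewrite -[LHS]mulgA E.
Qed.

Lemma phi_map_order (Omega : {set V}) w v n :
  m v = Some n -> phi_map Omega w v ^+ n = 1 :> W.
Proof.
move=> /(gen_order adj) gv; rewrite /phi_map; set c := pr _ _.
have -> : c * gen v * c^-1 = (gen v) ^ c^-1 by rewrite conjgE invgK mulgA.
by rewrite -conjXg gv conj1g.
Qed.

(** The splitting of conjugators at adjacent vertices survives projection, which preserves the
    subgroups of stars. *)
Lemma phi_map_comm (phi : aut W) (Omega : {set V}) w u v :
    conjugators phi w -> adj u v ->
  phi_map Omega w u * phi_map Omega w v = phi_map Omega w v * phi_map Omega w u.
Proof.
move=> cw uv; have [a [b [ua vb E]]] := conjugators_split cw uv.
rewrite /phi_map E !prM; set p := pr _ (w u).
have va := inW_pr_inW Omega vb; have ub := inW_pr_inW Omega ua.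
move: (pr _ a) (pr _ b) ub va => {a b ua vb E} a b.
move=> /gen_star_commute ua /gen_star_commute vb.
have -> : p * a * b * gen v * (p * a * b)^-1 = p * (a * gen v * a^-1) * p^-1.
  by rewrite !invgM !mulgA -[p * a * b * gen v]mulgA -vb !mulgA mulgK.
have com : commute (gen u) (a * gen v * a^-1).
  by apply: commuteM; [apply: commuteM => //; apply: gen_comm | apply: commuteV].
move: (a * gen v * a^-1) com => y com.
by rewrite !mulgA !mulgVK -[p * gen u * y]mulgA com mulgA.
Qed.

Definition omega_map (Omega : {set V}) w : W -> W := pres_lift (phi_map Omega w).

Section OmegaMap.
Variable Omega : {set V}.

Lemma omega_mapM (phi : aut W) w : conjugators phi w ->
  {morph omega_map Omega w : x y / x * y}.
Proof.
move=> cw; apply: gprod_liftM => [v n|u v]; first exact: phi_map_order.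
exact: phi_map_comm.
Qed.

Lemma omega_map_gen (phi : aut W) w v : conjugators phi w ->
  omega_map Omega w (gen v) = phi_map Omega w v.
Proof.
move=> cw; apply: gprod_lift_gen => [u n|u u']; first exact: phi_map_order.
exact: phi_map_comm.
Qed.

Lemma pr_omega_map (phi : aut W) w x : conjugators phi w ->
  pr Omega (phi x) = omega_map Omega w (pr Omega x).
Proof.
move=> cw; have oM := omega_mapM cw.
apply: (gprod_morph_eq (f := pr Omega \o phi) (g := omega_map Omega w \o pr Omega)).
- by move=> y z /=; rewrite autM prM.
- by move=> y z /=; rewrite prM oM.
- move=> v /=; rewrite cw !prM prV pr_gen; case: ifP => _.
    by rewrite (omega_map_gen _ cw).
  by rewrite mulg1 mulgV (morph_law1 oM).
Qed.

Lemma conjugators_mul (phi psi : aut W) w u :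
    conjugators phi w -> conjugators psi u ->
  conjugators (phi * psi) (fun v => phi (u v) * w v).
Proof.
move=> cw cu v.
by rewrite aut_mulE cu !autM cw (morph_lawV (autM phi)) invgM !mulgA.
Qed.

Lemma omega_map_mul (phi psi : aut W) w u v :
    conjugators phi w -> conjugators psi u ->
  omega_map Omega w (phi_map Omega u v) =
  phi_map Omega (fun v => phi (u v) * w v) v.
Proof.
move=> cw cu; have oM := omega_mapM cw.
rewrite /phi_map !oM (morph_lawV oM) (omega_map_gen _ cw) /phi_map.
by rewrite -!(pr_omega_map _ cw) prM invgM !mulgA.
Qed.

(** The composite is the map attached to the identity, which may be computed from trivial
    conjugators. *)
Lemma omega_map_cancel (phi psi : aut W) w u :
    conjugators phi w -> conjugators psi u -> phi * psi = 1 ->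
  cancel (omega_map Omega u) (omega_map Omega w).
Proof.
move=> cw cu E.
have wM := omega_mapM cw; have uM := omega_mapM cu.
apply: (gprod_morph_eq (f := omega_map Omega w \o omega_map Omega u) (g := id)) => //.
  by move=> y z /=; rewrite uM wM.
move=> v /=; rewrite (omega_map_gen _ cu) (omega_map_mul _ cw cu).
have c1 : conjugators (1 : aut W) (fun=> 1 : W).
  by move=> ?; rewrite aut_oneE mul1g invg1 mulg1.
have c2 := conjugators_mul cw cu; rewrite {}E in c2.
rewrite (conjugators_inj _ c2 c1) /phi_map pr1.
by rewrite mul1g invg1 mulg1.
Qed.

Lemma exists_omega_aut (phi : aut0 adj m) w : conjugators phi w ->
  exists psi : aut W, extends (phi_map Omega w) psi.
Proof.
move=> cw; have [u cu] := aut0_conjugators phi^-1.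
have oA : `[< is_aut (omega_map Omega w) >].
  apply/asboolP; split; last exact: omega_mapM cw.
  exists (omega_map Omega u).
    by apply: (omega_map_cancel cu cw); rewrite -[LHS]/(val (phi^-1 * phi)) mulVg.
  by apply: (omega_map_cancel cw cu); rewrite -[LHS]/(val (phi * phi^-1)) mulgV.
by exists (Aut oA) => v /=; apply: omega_map_gen cw.
Qed.

Lemma omega_aut_sig (phi : aut0 adj m) :
  exists psi : aut W, forall w, conjugators phi w -> extends (phi_map Omega w) psi.
Proof.
have [w cw] := aut0_conjugators phi.
have [psi psiE] := exists_omega_aut cw; exists psi => w' cw' v.
by rewrite psiE; apply: conjugators_inj cw cw' v.
Qed.

Definition omega_aut (phi : aut0 adj m) : aut W := projT1 (cid (omega_aut_sig phi)).

Lemma omega_autE (phi : aut0 adj m) w :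
  conjugators phi w -> extends (phi_map Omega w) (omega_aut phi).
Proof. exact: (projT2 (cid (omega_aut_sig phi))). Qed.

Lemma omega_autM : {morph omega_aut : phi psi / phi * psi}.
Proof.
move=> phi psi; have [w cw] := aut0_conjugators phi.
have [u cu] := aut0_conjugators psi.
have cwu : conjugators (phi * psi : aut0 adj m) (fun v => (phi : aut W) (u v) * w v).
  exact: conjugators_mul cw cu.
apply: (extends_unique (omega_autE cwu)) => v.
have wE x : omega_aut phi x = omega_map Omega w x.
  apply: gprod_morph_eq; [exact: autM | exact: omega_mapM cw|] => y.
  by rewrite (omega_autE cw) (omega_map_gen _ cw).
by rewrite aut_mulE (omega_autE cu) wE (omega_map_mul _ cw cu).
Qed.

Lemma omega_aut_gen (phi : aut0 adj m) :
  gen_subgroup (partial_conjs Omega) (omega_aut phi).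
Proof.
have [w cw] := aut0_conjugators phi.
apply: (@conj_in_gen_partial_conjs Omega _ (fun v => pr Omega (w v))).
  exact: omega_autE cw.
by move=> v; apply: inW_pr.
Qed.

Lemma omega_aut_fix (phi : aut0 adj m) :
  gen_subgroup (partial_conjs Omega) phi -> omega_aut phi = phi.
Proof.
(* The fixed points of a homomorphism form a subgroup, so only the generating partial conjugations
   need checking. *)
pose fixed := [set x : aut W | exists psi : aut0 adj m,
  x = psi /\ omega_aut psi = psi]%classic.
move=> /(_ fixed)[|psi [/val_inj -> //]]; split.
  have oV psi : omega_aut psi^-1 = (omega_aut psi)^-1.
    exact: (morph_lawV omega_autM).
  split=> [|x y]; rewrite !inE.
    by exists 1; split=> //; apply: (morph_law1 omega_autM).
  move=> [f [-> fE]] [g [-> gE]]; exists (f / g); split=> //.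
  by rewrite omega_autM oV fE gE.
move=> chi [i [K [iO KC chiE]]].
have chi0 : aut0_pred chi.
  apply/asboolP; apply: gen_partial_conjs_aut0.
  by apply: (@sub_gen_smallest _ _ (partial_conjs Omega)); exists i, K.
exists (Aut0 chi0); split=> //.
have cw : conjugators (Aut0 chi0) (fun j => if j \in K then gen i else 1).
  by move=> j; rewrite [LHS]chiE; case: ifP => _; rewrite // mul1g invg1 mulg1.
apply: (extends_unique (omega_autE cw)) => j; rewrite cw /phi_map.
by case: ifP => _; rewrite ?pr_gen ?iO // pr1.
Qed.

End OmegaMap.

End Heads.

Theorem theorem1p5 (V : finType) (adj : rel V) (m : V -> option nat)
    (V_nonempty : (0 < #|V|)%N)
    (adj_sym : symmetric adj) (adj_irr : irreflexive adj)
    (m_order : order_map m) (Omega : {set V}) :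
  (forall (phi : aut0 adj m) (w : V -> gprod adj m), conjugators phi w ->
     exists psi : aut (gprod adj m), extends (phi_map Omega w) psi)
  /\
  (exists r : {multiplicative aut0 adj m -> aut (gprod adj m)},
     [/\ forall (phi : aut0 adj m) (w : V -> gprod adj m),
           conjugators phi w -> extends (phi_map Omega w) (r phi),
         forall phi : aut0 adj m,
           gen_subgroup (partial_conjs Omega) (r phi)
       & forall phi : aut0 adj m,
           gen_subgroup (partial_conjs Omega) phi -> r phi = phi]).
Proof.
split; first by move=> phi w; apply: exists_omega_aut.
pose r := omega_aut adj_sym adj_irr m_order Omega.
pose rM := isMultiplicative.Build _ _ r (omega_autM adj_sym adj_irr m_order Omega).
pose rmorph : {multiplicative aut0 adj m -> aut (gprod adj m)} := HB.pack r rM.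
exists rmorph; split=> phi; first by move=> w; apply: omega_autE.
  exact: omega_aut_gen.
exact: omega_aut_fix.
Qed.
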